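(* Let $\mathcal{M}'_b: z(u,v)=f(u)\,l(v)+g(u)\,e_4$, $u\in I$, $v\in J$, be a meridian surface of type $\mathcal{M}'_b$ in $\mathbb{E}^4_2$ (so $l$ is a unit-speed timelike curve on $\mathbb{S}^2_1(1)$ and $f'^2-g'^2=1$). Then $\mathcal{M}'_b$ has non-zero constant mean curvature, i.e. $\langle H,H\rangle=c=\mathrm{const}$, $c\neq0$, if and only if the curve $l$ has constant curvature $\kappa=a=\mathrm{const}$, $a\neq0$, and the meridian curve $u\mapsto(f(u),g(u))$ is determined by $f'=\varphi(f)$, where $$\varphi(t)=\pm\frac1t\sqrt{\left(b\pm\frac t2\sqrt{a^2-4ct^2}\pm\frac{a^2}{4\sqrt c}\arcsin\frac{2\sqrt c\,t}{a}\right)^2+t^2}\quad\text{if } c>0,$$ $$\varphi(t)=\pm\frac1t\sqrt{\left(b\pm\frac t2\sqrt{a^2-4ct^2}\pm\frac{a^2}{4\sqrt{-c}}\ln\left|2\sqrt{-c}\,t+\sqrt{a^2-4ct^2}\right|\right)^2+t^2}\quad\text{if } c<0,$$ $b=\mathrm{const}$, and $g(u)$ is defined by $g'=\sqrt{f'^2-1}$.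
   Context: $\mathbb{E}^4_2$ is $\mathbb{R}^4$ with the inner product $\langle x,y\rangle=x_1y_1+x_2y_2-x_3y_3-x_4y_4$ and standard basis $e_1,e_2,e_3,e_4$. Let $\mathbb{E}^3_1=\mathrm{span}\{e_1,e_2,e_3\}$ and $\mathbb{S}^2_1(1)=\{V\in\mathbb{E}^3_1:\langle V,V\rangle=1\}$. Meridian surface of type $\mathcal{M}'_b$: let $I,J\subset\mathbb{R}$ be intervals, $f,g:I\to\mathbb{R}$ smooth with $f$ nowhere zero, $f'^2-g'^2=1$ and $g'>0$; let $l:J\to\mathbb{S}^2_1(1)$ be a smooth curve with $\langle l',l'\rangle=-1$. The surface is $z(u,v)=f(u)l(v)+g(u)e_4$. Its induced metric is Lorentzian, with orthonormal tangent frame $X=z_u$, $Y=z_v/f=l'$, $\langle X,X\rangle=1$, $\langle Y,Y\rangle=-1$. Curvature of $l$ (spherical curvature): put $t=l'$ and let $n$ be a vector field along $l$ (unique up to sign) such that $\{l,t,n\}$ is an orthonormal frame of $\mathbb{E}^3_1$ with $\langle n,n\rangle=1$; then $\kappa(v)=\langle t'(v),n(v)\rangle$, so that $t'=\kappa n+l$, $n'=\kappa t$. For a Lorentz surface with second fundamental form $h$, the mean curvature vector field is $H=\tfrac12\,\mathrm{tr}\,h=\tfrac12\left(h(E_1,E_1)-h(E_2,E_2)\right)$ for any local orthonormal tangent frame with $\langle E_1,E_1\rangle=1$, $\langle E_2,E_2\rangle=-1$. ''$f'=\varphi(f)$'' means $f'(u)=\varphi(f(u))$.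
   Formalization: For c<0 it is assumed that κ is not identically zero (otherwise ''only if'' fails, e.g. f=sinh u, g=cosh u, l a geodesic); the two inner ± signs of φ are matched so the bracket is a primitive of ±√(a²−4ct²); a²−4cf²≥0 is explicit; I and J are open. *)

(* Defs.v *)
(* MathComp-Analysis, over an arbitrary R : realType. *)
From HB Require Import structures.
From mathcomp Require Import all_boot all_order all_algebra.
From mathcomp Require Import all_classical all_reals all_analysis.

Set Implicit Arguments.
Unset Strict Implicit.
Unset Printing Implicit Defensive.

Import Order.TTheory GRing.Theory Num.Theory.
Import numFieldNormedType.Exports.

Local Open Scope classical_set_scope.
Local Open Scope ring_scope.

Section PseudoEuclidean.
Variable R : realType.

(* Indices are 0-based: [x 0 3] is the coordinate x_4. *)
Definition ip (x y : 'rV[R]_4) : R :=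
  x 0 0 * y 0 0 + x 0 1 * y 0 1 - x 0 2 * y 0 2 - x 0 3 * y 0 3.

Definition e4 : 'rV[R]_4 := delta_mx 0 3.

Definition in_E31 (x : 'rV[R]_4) : Prop := x 0 3 = 0.

Definition in_S21 (x : 'rV[R]_4) : Prop := in_E31 x /\ ip x x = 1.

(* Parameter intervals are open, so that differentiability of the total
   functions below at the points of the interval is the usual notion. *)
Definition open_interval (I : set R) : Prop :=
  [/\ is_interval I, open I & I !=set0].

Definition smooth_on (V : normedModType R) (I : set R) (f : R -> V) : Prop :=
  forall (k : nat) (x : R), I x -> derivable (derive1n k f) x 1.

End PseudoEuclidean.

Section SurfaceTheory.
Variables (R : realType) (z : R -> R -> 'rV[R]_4).

Definition z_u (u v : R) : 'rV[R]_4 := derive1 (fun s => z s v) u.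
Definition z_v (u v : R) : 'rV[R]_4 := derive1 (z u) v.
Definition z_uu (u v : R) : 'rV[R]_4 := derive1 (fun s => z_u s v) u.
Definition z_uv (u v : R) : 'rV[R]_4 := derive1 (z_u u) v.
Definition z_vv (u v : R) : 'rV[R]_4 := derive1 (z_v u) v.

(* A tangent vector at z(u,v) is given by its coordinates a : 'rV_2 in the
   basis (z_u, z_v). *)
Definition tangent (u v : R) (a : 'rV[R]_2) : 'rV[R]_4 :=
  a 0 0 *: z_u u v + a 0 1 *: z_v u v.

Definition metric (u v : R) (a b : 'rV[R]_2) : R :=
  ip (tangent u v a) (tangent u v b).

Definition gram (u v : R) : 'M[R]_2 :=
  \matrix_(i, j) metric u v (delta_mx 0 i) (delta_mx 0 j).

(* Component of w orthogonal to the tangent plane; meaningful where the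
   induced metric is nondegenerate, i.e. gram u v is invertible. *)
Definition normal_part (u v : R) (w : 'rV[R]_4) : 'rV[R]_4 :=
  w - tangent u v
        ((\row_i ip w (tangent u v (delta_mx 0 i))) *m invmx (gram u v)).

Definition second_fundamental_form (u v : R) (a b : 'rV[R]_2) : 'rV[R]_4 :=
  normal_part u v
    ((a 0 0 * b 0 0) *: z_uu u v
     + (a 0 0 * b 0 1 + a 0 1 * b 0 0) *: z_uv u v
     + (a 0 1 * b 0 1) *: z_vv u v).

Definition lorentz_frame (u v : R) (E1 E2 : 'rV[R]_2) : Prop :=
  [/\ metric u v E1 E1 = 1, metric u v E2 E2 = -1 & metric u v E1 E2 = 0].

(* The existence clause says that the induced metric is Lorentzian, so that
   the second clause is never vacuous and determines H. *)
Definition is_mean_curvature_vector (u v : R) (H : 'rV[R]_4) : Prop :=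
  (exists E1 E2, lorentz_frame u v E1 E2) /\
  forall E1 E2, lorentz_frame u v E1 E2 ->
    H = 2^-1 *: (second_fundamental_form u v E1 E1
                 - second_fundamental_form u v E2 E2).

Definition constant_mean_curvature (I J : set R) (c : R) : Prop :=
  forall u v, I u -> J v ->
    exists2 H, is_mean_curvature_vector u v H & ip H H = c.

End SurfaceTheory.

Section MeridianSurface.
Variable R : realType.

Definition meridian_data_b (I J : set R) (f g : R -> R) (l : R -> 'rV[R]_4)
    : Prop :=
  [/\ open_interval I, open_interval J,
      [/\ smooth_on I f, smooth_on I g
        & smooth_on J l],
      (forall u, I u ->
        [/\ f u != 0, derive1 f u ^+ 2 - derive1 g u ^+ 2 = 1 & 0 < derive1 g u])
    & (forall v, J v -> in_S21 (l v) /\ ip (derive1 l v) (derive1 l v) = -1)].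

Definition meridian_surface (f g : R -> R) (l : R -> 'rV[R]_4) (u v : R)
    : 'rV[R]_4 :=
  f u *: l v + g u *: e4 R.

(* With l in S^2_1(1) and t = l' unit timelike, this makes (l, t, n) an
   orthonormal frame field of E^3_1; n is determined up to sign. *)
Definition spherical_normal (J : set R) (l n : R -> 'rV[R]_4) : Prop :=
  smooth_on J n /\
  forall v, J v ->
    [/\ in_E31 (n v), ip (n v) (n v) = 1, ip (n v) (l v) = 0
      & ip (n v) (derive1 l v) = 0].

Definition spherical_curvature (l n : R -> 'rV[R]_4) (v : R) : R :=
  ip (derive1 (derive1 l) v) (n v).

Definition radicand (a c t : R) : R := a ^+ 2 - 4 * c * t ^+ 2.

(* The two inner signs are correlated, so that the bracket is a primitive of
   (-1) ^+ e * sqrt (a^2 - 4 c t^2). Differentiating arcsin (2 sqrt c t / a)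
   produces the factor |a| / a, which Num.sg a cancels: the two signs are equal
   for a > 0 and opposite for a < 0. *)
Definition phi_bracket (a b c : R) (e : bool) (t : R) : R :=
  if 0 < c then
    b + (-1) ^+ e * (t / 2 * Num.sqrt (radicand a c t))
      + (-1) ^+ e * Num.sg a *
          (a ^+ 2 / (4 * Num.sqrt c) * asin (2 * Num.sqrt c * t / a))
  else
    b + (-1) ^+ e * (t / 2 * Num.sqrt (radicand a c t))
      + (-1) ^+ e *
          (a ^+ 2 / (4 * Num.sqrt (- c)) *
           ln `|2 * Num.sqrt (- c) * t + Num.sqrt (radicand a c t)|).

Definition phi (a b c : R) (s e : bool) (t : R) : R :=
  (-1) ^+ s * (t^-1 * Num.sqrt (phi_bracket a b c e t ^+ 2 + t ^+ 2)).

(* [Num.sqrt] and [asin] are total, so the requirement that the formula for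
   phi be meaningful at f(u) is explicit; for c > 0 it also puts the argument
   of arcsin in [-1, 1]. *)
Definition meridian_determined (I : set R) (f g : R -> R) (a b c : R)
    (s e : bool) : Prop :=
  forall u, I u ->
    [/\ 0 <= radicand a c (f u),
        derive1 f u = phi a b c s e (f u)
      & derive1 g u = Num.sqrt (derive1 f u ^+ 2 - 1)].

End MeridianSurface.

(* Main.v *)
Require Import Defs.
From HB Require Import structures.
From mathcomp Require Import all_boot all_order all_algebra.
From mathcomp Require Import all_classical all_reals all_analysis.
From mathcomp Require Import ring lra.

(** In the orthonormal normal frame [n, m = g' l + f' e4] the mean curvature
    vector is [H = ((q / f) m - (kappa / f) n) / 2] with [q = g' + f f'' / g'],
    and [m] is timelike, so [<H, H> = c] reads [kappa^2 - q^2 = 4 c f^2]. The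
    variables separate: [kappa^2] is a constant [a^2], and by continuity [kappa]
    is constant. What remains is [q^2 = a^2 - 4 c f^2]. Since [f f' <> 0], the
    right-hand side cannot vanish, so [q = +- sqrt (a^2 - 4 c f^2)] with a fixed
    sign. As [(f g')' = f' q], integration gives [f g' = B (f)], where [B] is a
    primitive of [+- sqrt (a^2 - 4 c t^2)]; together with [f'^2 - g'^2 = 1] this
    is [f'^2 = (B (f)^2 + f^2) / f^2], and every step can be reversed. *)

Set Implicit Arguments.
Unset Strict Implicit.
Unset Printing Implicit Defensive.

Import Order.TTheory GRing.Theory Num.Theory.
Import numFieldNormedType.Exports.

Local Open Scope classical_set_scope.
Local Open Scope ring_scope.

(** * Continuity, signs and constancy on an interval *)

Section RealFunctions.
Variable R : realType.
Implicit Types (I : set R) (h p q f : R -> R).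

Lemma derivable_continuous (V : normedModType R) (h : R -> V) (x : R) :
  derivable h x 1 -> {for x, continuous h}.
Proof. by move=> /derivable1_diffP; exact: differentiable_continuous. Qed.

Lemma is_derive_derive1 (V : normedModType R) (h : R -> V) (x : R) :
  derivable h x 1 -> is_derive x 1 h (derive1 h x).
Proof. by move=> dh; rewrite derive1E; exact: derivableP. Qed.

(* [is_deriveM] in pointwise form, with products instead of scalings. *)
Lemma is_derive_mul p q (x dp dq : R) :
  is_derive x 1 p dp -> is_derive x 1 q dq ->
  is_derive x 1 (fun t => p t * q t) (dp * q x + p x * dq).
Proof.
move=> hp hq; apply: (is_derive_eq (is_deriveM hp hq)).
by rewrite addrC [X in X + _]mulrC.
Qed.

Lemma is_derive_mulc (k : R) q (x dq : R) :
  is_derive x 1 q dq -> is_derive x 1 (fun t => k * q t) (k * dq).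
Proof.
move=> hq; apply: (is_derive_eq (is_derive_mul (is_derive_cst k x 1) hq)).
by rewrite mul0r add0r.
Qed.

(** The image of an interval under a continuous function is connected, hence an interval; with
    values of both signs it would contain 0. *)
Lemma nonvanishing_sign I h : is_interval I ->
  (forall x, I x -> {for x, continuous h}) -> (forall x, I x -> h x != 0) ->
  exists e : bool, forall x, I x -> 0 < (-1) ^+ e * h x.
Proof.
move=> itvI ch h0.
have /connected_intervalP itvh : connected (h @` I).
  apply: connected_continuous_connected; first exact/connected_intervalP.
  by apply: continuous_in_subspaceT => x /[!inE]; exact: ch.
have same x y : I x -> I y -> h x < 0 -> 0 < h y -> False.
  move=> Ix Iy hx hy.
  have [|z Iz hz] := itvh _ _ (imageP h Ix) (imageP h Iy) 0; first by rewrite !ltW.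
  by move: (h0 _ Iz); rewrite hz eqxx.
have [[x0 [Ix0 hx0]]|noneg] := pselect (exists x, I x /\ h x < 0).
  exists true => x Ix; rewrite mulN1r oppr_gt0.
  by case: ltgtP (h0 x Ix) => // hx _; case: (same _ _ Ix0 Ix hx0 hx).
exists false => x Ix; rewrite mul1r.
by case: ltgtP (h0 x Ix) => // hx _; case: noneg; exists x.
Qed.

(** At each point [p = q] or [p = - q], and the sign of [p * q] tells which. That product is
    continuous and nowhere zero, so the choice is the same at all points. Every sign in the formula
    for [phi] arises in this way. *)
Lemma sqr_eq_sign I p q : is_interval I ->
  (forall x, I x -> {for x, continuous p}) ->
  (forall x, I x -> {for x, continuous q}) ->
  (forall x, I x -> q x != 0) -> (forall x, I x -> p x ^+ 2 = q x ^+ 2) ->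
  exists e : bool, forall x, I x -> p x = (-1) ^+ e * q x.
Proof.
move=> itvI cp cq q0 pq.
have p0 x : I x -> p x != 0 by move=> Ix; rewrite -sqrf_eq0 pq// sqrf_eq0 q0.
have [|x Ix|e He] := @nonvanishing_sign I (fun x => p x * q x) itvI.
- by move=> x Ix; apply: cvgM; [exact: cp|exact: cq].
- by rewrite mulf_neq0 ?p0 ?q0.
exists e => x Ix; have := He x Ix; have := q0 x Ix.
have /eqP := pq x Ix; rewrite eqf_sqr => /orP[]/eqP ->;
  case: e {He} => q0x; rewrite ?mul1r ?mulN1r ?mulNr -?expr2 //.
  by rewrite oppr_gt0 ltNge sqr_ge0.
by rewrite oppr_gt0 ltNge sqr_ge0.
Qed.

Lemma is_derive0_constant I h : is_interval I ->
  (forall x, I x -> is_derive x 1 h 0) -> forall x y, I x -> I y -> h x = h y.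
Proof.
move=> itvI dh x y; wlog xy : x y / x <= y.
  by move=> H Ix Iy; case: (leP x y) => [/H ->|/ltW /H ->].
move=> Ix Iy; have itvxy z : z \in `[x, y] -> I z.
  by rewrite in_itv/=; exact: itvI.
have [||z _ /eqP] := @MVT_segment R h (fun=> 0) x y xy.
- move=> z zxy; apply: dh; apply: itvxy; exact: subset_itv_oo_cc.
- apply: derivable_within_continuous => z /itvxy Iz.
  by have [] := dh z Iz.
by rewrite mul0r subr_eq0 => /eqP.
Qed.

End RealFunctions.

(** * The primitive of the square root *)

Section MeridianODE.
Variable R : realType.
Implicit Types (a b c t : R) (e s : bool).

Lemma is_derive_radicand a c t :
  is_derive t 1 (radicand a c) (- (8 * c * t)).
Proof.
have dsqr := is_derive_mul (is_derive_id t 1) (is_derive_id t (1 : R)).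
apply: (is_derive_eq (is_deriveB (is_derive_cst (a ^+ 2) t 1)
  (is_derive_mulc (4 * c) dsqr))).
by ring.
Qed.

(* A zero of the radicand at an interior point would be a minimum, where its
   derivative [- 8 c f f'] vanishes. *)
Lemma radicand_gt0 (I : set R) (f : R -> R) a c : open I -> c != 0 ->
  (forall u, I u -> [/\ derivable f u 1, f u != 0 & derive1 f u != 0]) ->
  (forall u, I u -> 0 <= radicand a c (f u)) ->
  forall u, I u -> 0 < radicand a c (f u).
Proof.
move=> oI c0 If rad_ge0 u Iu; rewrite lt_neqAle rad_ge0// andbT.
apply/negP => /eqP rad0.
have [df fu0 f'u0] := If u Iu.
have [e e0 Ie] : exists2 e, 0 < e & forall t, t \in `](u - e), (u + e)[ -> I t.
  have /nbhs_ballP[e e0 Ie] : nbhs u I by exact: open_nbhs_nbhs.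
  exists e => // t; rewrite in_itv/= => /andP[t1 t2]; apply: Ie.
  by rewrite /ball/= ltr_norml; lra.
have drad t : I t ->
    is_derive t 1 (fun t => radicand a c (f t)) (- (8 * c * f t * derive1 f t)).
  move=> /If[/is_derive_derive1 dft _ _].
  apply: (is_derive_eq (is_derive1_comp (is_derive_radicand _ _ _) dft)).
  by rewrite mulNr.
have [|t /Ie It|||_] :=
    @derive1_at_min R (fun t => radicand a c (f t)) (u - e) (u + e) u.
- by lra.
- by case: (drad t It).
- by rewrite in_itv/=; lra.
- by move=> t /Ie It; rewrite -rad0; exact: rad_ge0.
have [_ ->] := drad u Iu.
apply/eqP; rewrite oppr_eq0 !mulf_neq0//.
Qed.

Lemma is_derive_sqrt_radicand a c t : 0 < radicand a c t ->
  is_derive t 1 (fun t => Num.sqrt (radicand a c t))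
    (- (4 * c * t) / Num.sqrt (radicand a c t)).
Proof.
move=> rad0; apply: (is_derive_eq (is_derive1_comp (is_derive1_sqrt rad0)
  (is_derive_radicand a c t))).
by field; rewrite gt_eqF// sqrtr_gt0.
Qed.

(** The derivative is put in this form, through [a^2 = S^2 + 4 c t^2] with [S] the square root, so
    that the excess [a^2 / (2 S)] is exactly what the arcsine or logarithm term compensates. *)
Lemma is_derive_sqrt_part a c t : 0 < radicand a c t ->
  is_derive t 1 (fun t => t / 2 * Num.sqrt (radicand a c t))
    (Num.sqrt (radicand a c t)
     - a ^+ 2 / 2 / Num.sqrt (radicand a c t)).
Proof.
move=> rad0; apply: (is_derive_eq (is_derive_mul
  (is_derive_mul (is_derive_id t 1) (is_derive_cst (2^-1 : R) t 1))
  (is_derive_sqrt_radicand rad0))).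
have S0 : Num.sqrt (radicand a c t) != 0 by rewrite gt_eqF// sqrtr_gt0.
have -> : a ^+ 2 = Num.sqrt (radicand a c t) ^+ 2 + 4 * c * t ^+ 2.
  by rewrite sqr_sqrtr ?ltW// /radicand subrK.
by rewrite /cst/=; field.
Qed.

Lemma is_derive_asin_part a c t : 0 < c -> a != 0 -> 0 < radicand a c t ->
  is_derive t 1
    (fun t => Num.sg a *
       (a ^+ 2 / (4 * Num.sqrt c) * asin (2 * Num.sqrt c * t / a)))
    (a ^+ 2 / 2 / Num.sqrt (radicand a c t)).
Proof.
move=> c0 a0 rad0.
have S0 : 0 < Num.sqrt (radicand a c t) by rewrite sqrtr_gt0.
have r0 : 0 < Num.sqrt c by rewrite sqrtr_gt0.
have na0 : 0 < `|a| by rewrite normr_gt0.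
(* This identity serves twice: its right side is positive, which puts the argument of [asin]
   strictly inside (-1, 1), and its square root is the denominator in the derivative of [asin]. *)
have cosE : 1 - (2 * Num.sqrt c * t / a) ^+ 2
    = (Num.sqrt (radicand a c t) / `|a|) ^+ 2.
  rewrite [RHS]expr_div_n sqr_sqrtr ?ltW// real_normK ?num_real// /radicand.
  by rewrite !exprMn sqr_sqrtr ?ltW//; field.
have xlt1 : -1 < 2 * Num.sqrt c * t / a < 1.
  rewrite -ltr_norml -(@ltr_pXn2r _ 2) ?nnegrE// expr1n real_normK ?num_real//.
  by rewrite -subr_gt0 cosE exprn_gt0// divr_gt0.
have dlin : is_derive t 1 (fun t => 2 * Num.sqrt c * t / a) (2 * Num.sqrt c / a).
  apply: (is_derive_eq (is_derive_mul
    (is_derive_mulc (2 * Num.sqrt c) (is_derive_id t 1))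
    (is_derive_cst (a^-1 : R) t 1))).
  by rewrite /cst/=; ring.
have dasin := is_derive1_comp (g := fun t => _ * t / a) (is_derive1_asin xlt1) dlin.
apply: (is_derive_eq (is_derive_mulc (Num.sg a)
  (is_derive_mulc (a ^+ 2 / (4 * Num.sqrt c)) dasin))).
rewrite cosE sqrtr_sqr ger0_norm ?divr_ge0 ?ltW//.
rewrite /cst/=.
have sgn : `|a| = Num.sg a * a by rewrite normrEsg.
have sg2 : Num.sg a ^+ 2 = 1 by rewrite sqr_sg a0.
have sg0 : Num.sg a != 0 by rewrite sgr_eq0.
(* Once [|a|] is written as [Num.sg a * a], [field] treats [Num.sg a] as an unknown, so the relation
   [Num.sg a ^+ 2 = 1] is supplied by hand. *)
transitivity (Num.sg a ^+ 2 * (a ^+ 2 / 2 / Num.sqrt (radicand a c t)));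
  last by rewrite sg2 mul1r.
by rewrite sgn; field; rewrite a0 sg0 !gt_eqF.
Qed.

Lemma norm_lt_sqrt_radicand a c t : c < 0 -> a != 0 ->
  `|2 * Num.sqrt (- c) * t| < Num.sqrt (radicand a c t).
Proof.
move=> c0 a0.
have a2 : 0 < a ^+ 2 by rewrite exprn_even_gt0.
have := sqr_ge0 t => t2.
have rad0 : 0 < radicand a c t by rewrite /radicand; nra.
rewrite -sqrtr_sqr ltr_sqrt// !exprMn sqr_sqrtr ?oppr_ge0 ?ltW// /radicand; nra.
Qed.

Lemma is_derive_ln_part a c t : c < 0 -> a != 0 ->
  is_derive t 1
    (fun t => a ^+ 2 / (4 * Num.sqrt (- c)) *
       ln `|2 * Num.sqrt (- c) * t + Num.sqrt (radicand a c t)|)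
    (a ^+ 2 / 2 / Num.sqrt (radicand a c t)).
Proof.
move=> c0 a0.
have pos x : 0 < 2 * Num.sqrt (- c) * x + Num.sqrt (radicand a c x).
  by have := norm_lt_sqrt_radicand x c0 a0; rewrite ltr_norml; lra.
under [X in is_derive _ _ X]eq_fun do rewrite gtr0_norm//.
have S0 : 0 < Num.sqrt (radicand a c t).
  exact: le_lt_trans (norm_lt_sqrt_radicand t c0 a0).
have r0 : 0 < Num.sqrt (- c) by rewrite sqrtr_gt0 oppr_gt0.
have rad0 : 0 < radicand a c t by rewrite -sqrtr_gt0.
have darg := is_deriveD
  (is_derive_mulc (2 * Num.sqrt (- c)) (is_derive_id t 1))
  (is_derive_sqrt_radicand rad0).
have dln := is_derive1_comp
  (g := fun t => _ * t + Num.sqrt (radicand a c t)) (is_derive1_ln (pos t)) darg.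
apply: (is_derive_eq (is_derive_mulc (a ^+ 2 / (4 * Num.sqrt (- c))) dln)).
rewrite /cst/= .
(* With [c] expressed through [r = Num.sqrt (- c)], the derivative of the argument of [ln] is
   [2 r / S] times that argument, and [field] sees the cancellation. *)
have cE : c = - Num.sqrt (- c) ^+ 2 by rewrite sqr_sqrtr ?oppr_ge0 ?ltW// opprK.
move: (Num.sqrt (radicand a c t)) S0 (pos t) => S S0 pos'.
move: (Num.sqrt (- c)) r0 pos' cE => r r0 pos' ->.
field.
by rewrite !gt_eqF.
Qed.

(** The term [a^2 / (2 S)] lost by the algebraic part is restored by the arcsine for [c > 0] and by
    the logarithm for [c < 0]. *)
Lemma is_derive_phi_bracket a b c e t :
  c != 0 -> a != 0 -> 0 < radicand a c t ->
  is_derive t 1 (phi_bracket a b c e) ((-1) ^+ e * Num.sqrt (radicand a c t)).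
Proof.
move=> c0 a0 rad0; have dsqrt := is_derive_sqrt_part rad0.
have [cpos|cneg|c00] := ltgtP 0 c; last by rewrite -c00 eqxx in c0.
- have -> : phi_bracket a b c e = fun t =>
      b + (-1) ^+ e * (t / 2 * Num.sqrt (radicand a c t)) + (-1) ^+ e * (Num.sg a *
       (a ^+ 2 / (4 * Num.sqrt c) * asin (2 * Num.sqrt c * t / a))).
    by apply/funext => x; rewrite /phi_bracket cpos [in RHS](mulrA _ (Num.sg a)).
  apply: (is_derive_eq (is_deriveD (is_deriveD (is_derive_cst b t 1)
    (is_derive_mulc ((-1) ^+ e) dsqrt))
    (is_derive_mulc ((-1) ^+ e)
      (is_derive_asin_part cpos a0 rad0)))).
  by rewrite /cst/=; ring.
- have -> : phi_bracket a b c e = fun t =>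
      b + (-1) ^+ e * (t / 2 * Num.sqrt (radicand a c t)) + (-1) ^+ e *
       (a ^+ 2 / (4 * Num.sqrt (- c)) *
       ln `|2 * Num.sqrt (- c) * t + Num.sqrt (radicand a c t)|).
    by apply/funext => x; rewrite /phi_bracket ltNge ltW.
  apply: (is_derive_eq (is_deriveD (is_deriveD (is_derive_cst b t 1)
    (is_derive_mulc ((-1) ^+ e) dsqrt))
    (is_derive_mulc ((-1) ^+ e)
      (is_derive_ln_part t cneg a0)))).
  by rewrite /cst/=; ring.
Qed.

(** * The meridian equation *)

Section Meridian.
Variables (I : set R) (f g : R -> R).
Hypotheses (oI : open_interval I) (sf : smooth_on I f) (sg : smooth_on I g).
Hypothesis fg : forall u, I u ->
  [/\ f u != 0, derive1 f u ^+ 2 - derive1 g u ^+ 2 = 1 & 0 < derive1 g u].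

Let df u : I u -> is_derive u 1 f (derive1 f u).
Proof. by move=> Iu; apply: is_derive_derive1; exact: (@sf 0%N). Qed.

Let ddf u : I u -> is_derive u 1 (derive1 f) (derive1 (derive1 f) u).
Proof. by move=> Iu; apply: is_derive_derive1; exact: (@sf 1%N). Qed.

Let ddg u : I u -> is_derive u 1 (derive1 g) (derive1 (derive1 g) u).
Proof. by move=> Iu; apply: is_derive_derive1; exact: (@sg 1%N). Qed.

Let cf u : I u -> {for u, continuous f}.
Proof. by move=> Iu; apply: derivable_continuous; exact: (@sf 0%N). Qed.

Let cdf u : I u -> {for u, continuous (derive1 f)}.
Proof. by move=> Iu; apply: derivable_continuous; exact: (@sf 1%N). Qed.

Let cddf u : I u -> {for u, continuous (derive1 (derive1 f))}.
Proof. by move=> Iu; apply: derivable_continuous; exact: (@sf 2%N). Qed.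

Let cdg u : I u -> {for u, continuous (derive1 g)}.
Proof. by move=> Iu; apply: derivable_continuous; exact: (@sg 1%N). Qed.

Lemma meridian_derive2 u : I u ->
  derive1 f u * derive1 (derive1 f) u = derive1 g u * derive1 (derive1 g) u.
Proof.
move=> Iu.
have := is_deriveB (is_derive_mul (ddf Iu) (ddf Iu))
  (is_derive_mul (ddg Iu) (ddg Iu)).
(* The identity [f'^2 - g'^2 = 1] is known only on [I]; since [I] is open it holds near [u], which
   is enough to differentiate it. *)
have /near_eq_is_derive : \forall t \near u,
    (fun t => derive1 f t * derive1 f t - derive1 g t * derive1 g t) t
      = cst 1 t.
  have [_ opI _] := oI.
  have : nbhs u I by exact: open_nbhs_nbhs.
  by apply: filterS => t /fg[_ /= fg1 _]; rewrite -fg1 -!expr2.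
have half (x y z w : R) : 0 = x * y + y * x - (z * w + w * z) -> y * x = w * z.
  by lra.
by move=> /[apply] -[_]; rewrite derive_cst; exact: half.
Qed.

Lemma meridian_derive1_neq0 u : I u -> derive1 f u != 0.
Proof.
move=> /fg[_ fg1 _]; apply/eqP => f'0.
by move: fg1 (sqr_ge0 (derive1 g u)); rewrite f'0 expr0n/=; lra.
Qed.

(** Up to the factor [1 / (2 f)], the component of the mean curvature vector along the timelike
    normal [g' l + f' e4]. *)
Definition meridian_q u := derive1 g u + f u * derive1 (derive1 f) u / derive1 g u.

(** Substituting [g'' = f' f'' / g'] makes [f'] a common factor of [f' g' + f g'']. *)
Lemma is_derive_meridian_w u : I u ->
  is_derive u 1 (fun u => f u * derive1 g u) (derive1 f u * meridian_q u).
Proof.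
move=> Iu; apply: (is_derive_eq (is_derive_mul (df Iu) (ddg Iu))).
have [_ _ g'0] := fg Iu; have g'n0 : derive1 g u != 0 by rewrite gt_eqF.
have /(canRL (mulKf g'n0)) -> := esym (meridian_derive2 Iu).
by rewrite /meridian_q; field.
Qed.

Lemma continuous_meridian_q u : I u -> {for u, continuous meridian_q}.
Proof.
move=> Iu; have [_ _ g'0] := fg Iu.
apply: cvgD; first exact: cdg.
apply: cvgM; first by apply: cvgM; [exact: cf|exact: cddf].
by apply: cvgV; [rewrite gt_eqF|exact: cdg].
Qed.

(** Both directions of the equivalence provide only a nonnegative radicand, whereas differentiating
    its square root requires a positive one. *)
Lemma meridian_radicand_gt0 a c : c != 0 ->
  (forall u, I u -> 0 <= radicand a c (f u)) ->
  forall u, I u -> 0 < radicand a c (f u).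
Proof.
move=> c0; apply: radicand_gt0 => //; first by case: oI.
move=> u Iu; split; [exact: (@sf 0%N)|by case: (fg Iu)|].
exact: meridian_derive1_neq0.
Qed.

Lemma is_derive_phi_bracket_meridian a b c e u :
  c != 0 -> a != 0 -> I u -> 0 < radicand a c (f u) ->
  is_derive u 1 (fun u => phi_bracket a b c e (f u))
    (derive1 f u * ((-1) ^+ e * Num.sqrt (radicand a c (f u)))).
Proof.
move=> c0 a0 Iu rad0; apply: (is_derive_eq (is_derive1_comp
  (is_derive_phi_bracket b e c0 a0 rad0) (df Iu))).
exact: mulrC.
Qed.

(** Squaring [f' = phi (f)] removes [s] and, with [f'^2 - g'^2 = 1], gives [(f g')^2 = B (f)^2] for
    the bracket [B]. So [f g'] is [B (f)] up to one fixed sign; differentiating, cancelling [f'] and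
    squaring removes that sign and [e]. *)
Lemma meridian_q_of_determined a b c s e : c != 0 -> a != 0 ->
  meridian_determined I f g a b c s e ->
  forall u, I u -> meridian_q u ^+ 2 = radicand a c (f u).
Proof.
move=> c0 a0 det.
have rad0 := meridian_radicand_gt0 c0 (fun u Iu => let: And3 r _ _ := det u Iu in r).
have dB u (Iu : I u) := is_derive_phi_bracket_meridian b e c0 a0 Iu (rad0 u Iu).
have w2 u : I u ->
    (f u * derive1 g u) ^+ 2 = phi_bracket a b c e (f u) ^+ 2.
  move=> Iu; have [f0 fg1 _] := fg Iu; have [_ f'E _] := det u Iu.
  have -> : (f u * derive1 g u) ^+ 2 = f u ^+ 2 * derive1 f u ^+ 2 - f u ^+ 2.
    by rewrite -[X in _ = _ - X]mulr1 -fg1; ring.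
  rewrite f'E /phi exprMn sqrr_sign mul1r exprMn sqr_sqrtr ?addr_ge0 ?sqr_ge0//.
  by field.
(* The bracket inherits non-vanishing from [f g'], as [sqr_eq_sign] demands. *)
have B0 u : I u -> phi_bracket a b c e (f u) != 0.
  move=> Iu; rewrite -sqrf_eq0 -w2// sqrf_eq0 mulf_neq0//; first by case: (fg Iu).
  by rewrite gt_eqF//; case: (fg Iu).
have [itvI opI _] := oI.
have [|u Iu|d wE] := sqr_eq_sign itvI _ _ B0 w2.
- by move=> u /is_derive_meridian_w[+ _]; exact: derivable_continuous.
- by case: (dB u Iu) => + _; exact: derivable_continuous.
move=> u Iu; have := is_derive_mulc ((-1) ^+ d) (dB u Iu).
have /near_eq_is_derive : \forall t \near u,
    (fun t => (-1) ^+ d * phi_bracket a b c e (f t)) t = f t * derive1 g t.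
  have : nbhs u I by exact: open_nbhs_nbhs.
  by apply: filterS => t It; rewrite wE.
move=> /[apply] -[_]; have [_ ->] := is_derive_meridian_w Iu.
rewrite mulrCA => /(mulfI (meridian_derive1_neq0 Iu)) ->.
by rewrite !exprMn !sqrr_sign !mul1r sqr_sqrtr// ltW// rad0.
Qed.

(** The three parameters come from three choices: [e] is the sign of [q], [b] the constant of
    integration, and [s] the sign of [f'] relative to [f]. *)
Lemma determined_of_meridian_q a c : c != 0 -> a != 0 ->
  (forall u, I u -> meridian_q u ^+ 2 = radicand a c (f u)) ->
  exists b s e, meridian_determined I f g a b c s e.
Proof.
move=> c0 a0 qE.
have rad0 : forall u, I u -> 0 < radicand a c (f u).
  by apply: meridian_radicand_gt0 => // u Iu; rewrite -qE// sqr_ge0.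
have [itvI opI [u0 Iu0]] := oI.
have crad u : I u -> {for u, continuous (fun u => Num.sqrt (radicand a c (f u)))}.
  move=> Iu; apply: derivable_continuous.
  by case: (is_derive1_comp (is_derive_sqrt_radicand (rad0 _ Iu)) (df Iu)).
have [||e qe] := sqr_eq_sign itvI continuous_meridian_q crad.
- by move=> u Iu; rewrite gt_eqF// sqrtr_gt0 rad0.
- by move=> u Iu; rewrite qE// sqr_sqrtr// ltW// rad0.
(* The bracket depends on [b] additively, so this value makes it agree with [f g'] at [u0]; equal
   derivatives then give agreement on all of [I]. *)
pose b := f u0 * derive1 g u0 - phi_bracket a 0 c e (f u0).
have bracketE t : phi_bracket a b c e t = b + phi_bracket a 0 c e t.
  by rewrite /phi_bracket; case: ifP => _; rewrite add0r !addrA.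
have wE u : I u -> f u * derive1 g u = phi_bracket a b c e (f u).
  move=> Iu; rewrite bracketE; apply/eqP; rewrite -subr_eq; apply/eqP.
  apply: (is_derive0_constant
    (h := fun u => f u * derive1 g u - phi_bracket a 0 c e (f u)) itvI) => // t It.
  apply: (is_derive_eq (is_deriveB (is_derive_meridian_w It)
    (is_derive_phi_bracket_meridian 0 e c0 a0 It (rad0 _ It)))).
  by rewrite qe// subrr.
(* [F] is [phi] at [f u] without its outer sign, with [f g'] in place of the bracket. *)
pose F u := (f u)^-1 * Num.sqrt ((f u * derive1 g u) ^+ 2 + f u ^+ 2).
have F2 u : I u -> derive1 f u ^+ 2 = F u ^+ 2.
  move=> /fg[fu0 fg1 _]; rewrite exprMn sqr_sqrtr ?addr_ge0 ?sqr_ge0//.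
  rewrite -[LHS](subrK (derive1 g u ^+ 2)) fg1.
  by field.
have F0 u : I u -> F u != 0.
  by move=> Iu; rewrite -sqrf_eq0 -F2// sqrf_eq0 meridian_derive1_neq0.
have cF u : I u -> {for u, continuous F}.
  move=> Iu; have [fu0 _ _] := fg Iu.
  apply: cvgM; first by apply: cvgV => //; exact: cf.
  apply: (@continuous_comp _ _ _
    (fun u => (f u * derive1 g u) ^+ 2 + f u ^+ 2) Num.sqrt); last first.
    exact: sqrt_continuous.
  apply: cvgD; apply: cvgM; [| |exact: cf|exact: cf];
    by apply: cvgM; [exact: cf|exact: cdg].
have [s sE] := sqr_eq_sign itvI cdf cF F0 F2.
exists b, s, e => u Iu; have [_ fg1 g'0] := fg Iu; split.
- by rewrite ltW// rad0.
- by rewrite sE// /F wE.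
- have -> : derive1 f u ^+ 2 - 1 = derive1 g u ^+ 2 by rewrite -fg1; ring.
  by rewrite sqrtr_sqr gtr0_norm.
Qed.

End Meridian.

End MeridianODE.

(** * Lorentz surfaces in orthogonal coordinates *)

Section Geometry.
Variable R : realType.
Implicit Types (x y w : 'rV[R]_4) (k : R).

Lemma ipC x y : ip x y = ip y x.
Proof. by rewrite /ip; ring. Qed.

Lemma ipDl x y w : ip (x + y) w = ip x w + ip y w.
Proof. by rewrite /ip !mxE; ring. Qed.

Lemma ipDr x y w : ip w (x + y) = ip w x + ip w y.
Proof. by rewrite /ip !mxE; ring. Qed.

Lemma ipZl k x y : ip (k *: x) y = k * ip x y.
Proof. by rewrite /ip !mxE; ring. Qed.

Lemma ipZr k x y : ip x (k *: y) = k * ip x y.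
Proof. by rewrite /ip !mxE; ring. Qed.

Lemma ip_e4 x : ip x (e4 R) = - x 0 3.
Proof. by rewrite /ip /e4 !mxE/=; ring. Qed.

Lemma ip_e4_e4 : ip (e4 R) (e4 R) = -1.
Proof. by rewrite ip_e4 mxE. Qed.

(* With B the matrix whose rows are the [b i] and G the Gram matrix of the
   standard basis, [B G B^T E = 1] gives [G B^T E B = 1]. *)
Lemma ip_orthonormal_expansion (b : 'I_4 -> 'rV[R]_4) (eps : 'I_4 -> R) w :
  (forall i, eps i ^+ 2 = 1) ->
  (forall i j, ip (b i) (b j) = eps i *+ (i == j)) ->
  ip w w = \sum_i eps i * ip w (b i) ^+ 2.
Proof.
move=> eps2 bE.
pose G : 'M[R]_4 := diag_mx (\row_i (if (i < 2)%N then 1 else -1)).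
have ipE x y : ip x y = (x *m G *m y^T) 0 0.
  rewrite mul_mx_diag !mxE !big_ord_recl big_ord0 !mxE/= /ip.
  have -> : lift ord0 ord0 = 1 :> 'I_4 by apply/val_inj.
  have -> : lift ord0 (lift ord0 ord0) = 2 :> 'I_4 by apply/val_inj.
  have -> : lift ord0 (lift ord0 (lift ord0 ord0)) = 3 :> 'I_4 by apply/val_inj.
  by ring.
pose B : 'M[R]_4 := \matrix_i b i.
pose E : 'M[R]_4 := diag_mx (\row_i eps i).
have xGB x i : (x *m G *m B^T) 0 i = ip x (b i).
  by rewrite ipE !mxE; apply: eq_bigr => j _; rewrite !mxE.
have BGx x i : (B *m G *m x^T) i 0 = ip x (b i).
  by rewrite ipC ipE -(rowK b i) -!row_mul [RHS]mxE.
have BGB : B *m G *m B^T = E.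
  apply/matrixP => i j.
  have -> : (B *m G *m B^T) i j = row i (B *m G *m B^T) 0 j by rewrite [RHS]mxE.
  by rewrite !row_mul rowK xGB bE !mxE.
have : B *m (G *m B^T *m E) = 1%:M.
  rewrite !mulmxA BGB mulmx_diag; apply/matrixP => i j; rewrite !mxE.
  by case: eqP => //= _; rewrite -expr2 eps2.
move/mulmx1C => GBEB.
rewrite ipE -[X in X *m G *m w^T]mulmx1 -GBEB.
have -> : w *m (G *m B^T *m E *m B) *m G *m w^T
    = (w *m G *m B^T *m E) *m (B *m G *m w^T) by rewrite !mulmxA.
rewrite mxE; apply: eq_bigr => i _.
by rewrite BGx mul_mx_diag mxE xGB mxE; ring.
Qed.

(** * Derivatives of vector-valued curves *)

Lemma is_derive_mx m p (M : R -> 'M[R]_(m, p)) (t : R) (dM : 'M[R]_(m, p)) :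
  (forall i j, is_derive t 1 (fun t => M t i j) (dM i j)) -> is_derive t 1 M dM.
Proof.
move=> dMij.
have dMt : derivable M t 1 by apply/derivable_mxP => i j; case: (dMij i j).
apply: DeriveDef => //; rewrite derive_mx//.
by apply/matrixP => i j; rewrite mxE; case: (dMij i j).
Qed.

Lemma is_derive_coord m p (M : R -> 'M[R]_(m, p)) (t : R) (dM : 'M[R]_(m, p)) i j :
  is_derive t 1 M dM -> is_derive t 1 (fun t => M t i j) (dM i j).
Proof.
move=> [dMt <-]; apply: DeriveDef; first by move/derivable_mxP: dMt; apply.
by rewrite derive_mx// mxE.
Qed.

Lemma is_derive_ip (a b : R -> 'rV[R]_4) (t : R) da db :
  is_derive t 1 a da -> is_derive t 1 b db ->
  is_derive t 1 (fun t => ip (a t) (b t)) (ip da (b t) + ip (a t) db).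
Proof.
move=> ha hb.
have d i := is_derive_mul (is_derive_coord 0 i ha) (is_derive_coord 0 i hb).
apply: (is_derive_eq (is_deriveB (is_deriveB (is_deriveD (d 0) (d 1)) (d 2)) (d 3))).
by rewrite /ip; ring.
Qed.

Lemma is_derive_scale (V : R -> 'rV[R]_4) (h : R -> R) (t : R) dV dh :
  is_derive t 1 h dh -> is_derive t 1 V dV ->
  is_derive t 1 (fun t => h t *: V t) (dh *: V t + h t *: dV).
Proof.
move=> hh hV; apply: is_derive_mx => i j.
under [X in is_derive _ _ X]eq_fun do rewrite mxE.
by rewrite !mxE; apply: is_derive_mul => //; exact: is_derive_coord.
Qed.

(** Differentiating the relations that hold along [l] with this lemma yields all the products of
    [l], [l'], [l''] and [e4] used below. *)
Lemma is_derive_ip_const (J : set R) (a b : R -> 'rV[R]_4) (t : R) da db k :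
  open J -> J t -> (forall v, J v -> ip (a v) (b v) = k) ->
  is_derive t 1 a da -> is_derive t 1 b db -> ip da (b t) + ip (a t) db = 0.
Proof.
move=> oJ Jt abk ha hb.
have /near_eq_is_derive : \forall v \near t, (fun v => ip (a v) (b v)) v = cst k v.
  by have : nbhs t J by [exact: open_nbhs_nbhs]; apply: filterS.
by move=> /(_ _ _ (is_derive_ip ha hb)) -[_ <-]; rewrite derive_cst.
Qed.

(** * The mean curvature vector where the metric is [du^2 - r^2 dv^2] *)

Section OrthogonalCoordinates.
Variables (z : R -> R -> 'rV[R]_4) (u v r : R).
Hypotheses (r0 : r != 0) (zuu : ip (z_u z u v) (z_u z u v) = 1)
  (zuv : ip (z_u z u v) (z_v z u v) = 0)
  (zvv : ip (z_v z u v) (z_v z u v) = - r ^+ 2).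

Lemma metric_orthogonal (a b : 'rV[R]_2) :
  metric z u v a b = a 0 0 * b 0 0 - r ^+ 2 * (a 0 1 * b 0 1).
Proof.
rewrite /metric /tangent; move: zuu zuv zvv.
move: (z_u z u v) (z_v z u v) => p q pp pq qq.
by rewrite !(ipDl, ipDr, ipZl, ipZr) (ipC q p) pp pq qq; ring.
Qed.

(** The inverse Gram matrix is diagonal with entries [1] and [- r^-2]; the plus sign in the last
    term reflects that [z_v] is timelike. *)
Lemma normal_part_orthogonal w :
  normal_part z u v w =
    w - ip w (z_u z u v) *: z_u z u v
      + (r ^- 2 * ip w (z_v z u v)) *: z_v z u v.
Proof.
have invE : invmx (gram z u v) = diag_mx (\row_i (if i == 0 then 1 else - r ^- 2)).
  have gE : gram z u v *m diag_mx (\row_i (if i == 0 then 1 else - r ^- 2)) = 1%:M.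
    rewrite mul_mx_diag; apply/matrixP => i j; rewrite !mxE metric_orthogonal !mxE/=.
    by case: i => -[|[|//]] ?; case: j => -[|[|//]] ?;
      rewrite /= ?(mulr0, mulr1, mul0r, mul1r, subr0, sub0r, mulr1n, mulr0n, oppr0)//
        mulrNN mulfV// expf_neq0.
  have [gU _] := mulmx1_unit gE.
  by rewrite -[LHS]mulmx1 -gE mulmxA mulVmx// mul1mx.
rewrite /normal_part invE mul_mx_diag {1}/tangent !mxE/=.
have -> : tangent z u v (delta_mx 0 0) = z_u z u v.
  by rewrite /tangent !mxE/= scale1r scale0r addr0.
have -> : tangent z u v (delta_mx 0 1) = z_v z u v.
  by rewrite /tangent !mxE/= scale1r scale0r add0r.
move: (z_u z u v) (z_v z u v) => p q.
by apply/rowP => i; rewrite !mxE; move: (ip _ _) (ip _ _) => *; ring.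
Qed.

(** The three equations are the entries of [E1^T E1 - E2^T E2], which is the inverse metric whatever
    the frame. Hence the trace of the second fundamental form does not depend on the frame. *)
Lemma lorentz_frame_orthogonal (E1 E2 : 'rV[R]_2) : lorentz_frame z u v E1 E2 ->
  [/\ E1 0 0 ^+ 2 - E2 0 0 ^+ 2 = 1, E1 0 0 * E1 0 1 - E2 0 0 * E2 0 1 = 0
    & E1 0 1 ^+ 2 - E2 0 1 ^+ 2 = - r ^- 2].
Proof.
rewrite /lorentz_frame !metric_orthogonal.
move: (E1 0 0) (E1 0 1) (E2 0 0) (E2 0 1) => x1 y1 x2 y2 [h1 h2 h12].
(* Squaring the orthogonality relation [x1 x2 = r^2 y1 y2] and eliminating [x2^2] and [y1^2] by the
   two norm conditions leaves this equality. *)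
have x1E : x1 ^+ 2 = r ^+ 2 * y2 ^+ 2.
  have : (x1 * x2) ^+ 2 = (r ^+ 2 * (y1 * y2)) ^+ 2 by congr (_ ^+ 2); lra.
  have -> : (r ^+ 2 * (y1 * y2)) ^+ 2
      = (r ^+ 2 * (y1 * y1)) * (r ^+ 2 * (y2 * y2)) by ring.
  have -> : r ^+ 2 * (y1 * y1) = x1 ^+ 2 - 1 by rewrite expr2; lra.
  have -> : (x1 * x2) ^+ 2 = x1 ^+ 2 * (x2 * x2) by ring.
  have -> : x2 * x2 = r ^+ 2 * (y2 * y2) - 1 by lra.
  rewrite -!expr2; lra.
have x2E : x2 ^+ 2 = r ^+ 2 * y1 ^+ 2.
  by move: h1 h2; rewrite -!expr2 x1E; lra.
have x10 : x1 != 0.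
  apply/eqP => x10; move: h1; rewrite x10 mul0r.
  by move: (sqr_ge0 (r * y1)); rewrite exprMn expr2 [y1 ^+ 2]expr2; lra.
have r20 : r ^+ 2 != 0 by rewrite expf_neq0.
split.
- by rewrite x1E -h1 x2E -!expr2 -x1E; lra.
- apply: (mulfI x10); rewrite mulr0 mulrBr.
  have -> : x1 * (x2 * y2) = r ^+ 2 * y2 ^+ 2 * y1.
    by rewrite mulrA (_ : x1 * x2 = r ^+ 2 * (y1 * y2)); [ring|lra].
  by rewrite -x1E; ring.
- apply: (mulfI r20); rewrite mulrN mulfV// mulrBr -x1E -h1; ring.
Qed.

Lemma mean_curvature_vector_orthogonal H :
  is_mean_curvature_vector z u v H <->
  H = 2^-1 *: normal_part z u v (z_uu z u v - r ^- 2 *: z_vv z u v).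
Proof.
have sffE E1 E2 : lorentz_frame z u v E1 E2 ->
    second_fundamental_form z u v E1 E1 - second_fundamental_form z u v E2 E2
      = normal_part z u v (z_uu z u v - r ^- 2 *: z_vv z u v).
  move=> /lorentz_frame_orthogonal[h0 h01 h1].
  rewrite /second_fundamental_form !normal_part_orthogonal.
  move: (z_uu _ _ _) (z_uv _ _ _) (z_vv _ _ _) (z_u _ _ _) (z_v _ _ _).
  move=> zss zst ztt zs zt.
  have -> : zss - r ^- 2 *: ztt =
     (E1 0 0 ^+ 2 - E2 0 0 ^+ 2) *: zss
     + (2 * (E1 0 0 * E1 0 1 - E2 0 0 * E2 0 1)) *: zst
     + (E1 0 1 ^+ 2 - E2 0 1 ^+ 2) *: ztt.
    by rewrite h0 h01 h1 mulr0 scale1r scale0r addr0 scaleNr.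
  rewrite !(ipDl, ipZl).
  apply/rowP => i; rewrite !mxE; do 6! [move: (ip _ _) => ?].
  by ring.
(* The frame [z_u, z_v / r] witnesses that the metric is Lorentzian, so the defining condition on
   [H] is not vacuous and fixes its value. *)
have frame : lorentz_frame z u v (delta_mx 0 0) (r^-1 *: delta_mx 0 1).
  rewrite /lorentz_frame !metric_orthogonal !mxE/=.
  by split; [ring|field|ring].
split=> [[_ HE]|->]; first by rewrite (HE _ _ frame) sffE.
by split=> [|E1 E2 /sffE ->//]; exists (delta_mx 0 0), (r^-1 *: delta_mx 0 1).
Qed.

End OrthogonalCoordinates.

End Geometry.

(** * Meridian surfaces *)

Section MeridianSurfaceCurvature.
Variables (R : realType) (I J : set R) (f g : R -> R) (l n : R -> 'rV[R]_4).
Hypotheses (hM : meridian_data_b I J f g l) (hn : spherical_normal J l n).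

Lemma is_derive_curve v : J v ->
  is_derive v 1 l (derive1 l v) /\
  is_derive v 1 (derive1 l) (derive1 (derive1 l) v).
Proof.
case: hM => _ _ [_ _ sl] _ _ Jv.
by split; apply: is_derive_derive1; [exact: (@sl 0%N)|exact: (@sl 1%N)].
Qed.

(** These are the derivatives of [<l, l> = 1], of the resulting [<l', l> = 0], and of
    [<l', l'> = -1]. *)
Lemma spherical_curve_products v : J v ->
  [/\ ip (derive1 l v) (l v) = 0, ip (derive1 (derive1 l) v) (l v) = 1
    & ip (derive1 (derive1 l) v) (derive1 l v) = 0].
Proof.
case: hM => _ [_ oJ _] _ _ hl Jv.
have l'l t : J t -> ip (derive1 l t) (l t) = 0.
  move=> Jt; have [dl _] := is_derive_curve Jt.
  have := is_derive_ip_const oJ Jt (fun v Jv => (hl v Jv).1.2) dl dl.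
  by rewrite (ipC (l t)); lra.
have [dl ddl] := is_derive_curve Jv; split; first exact: l'l.
- have := is_derive_ip_const oJ Jv l'l ddl dl.
  by rewrite (hl v Jv).2; lra.
- have := is_derive_ip_const oJ Jv (fun v Jv => (hl v Jv).2) ddl ddl.
  by rewrite [X in _ + X]ipC; lra.
Qed.

Lemma spherical_curve_e4 v : J v ->
  [/\ ip (l v) (e4 R) = 0, ip (derive1 l v) (e4 R) = 0
    & ip (derive1 (derive1 l) v) (e4 R) = 0].
Proof.
case: hM => _ [_ oJ _] _ _ hl Jv.
have le t : J t -> ip (l t) (e4 R) = 0.
  by move=> /hl[[l3 _] _]; rewrite ip_e4 l3 oppr0.
have l'e t : J t -> ip (derive1 l t) (e4 R) = 0.
  move=> Jt; have [dl _] := is_derive_curve Jt.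
  have := is_derive_ip_const oJ Jt le dl (is_derive_cst (e4 R) t 1).
  by rewrite -(scale0r (e4 R)) ipZr mul0r addr0.
split; [exact: le|exact: l'e|]; have [_ ddl] := is_derive_curve Jv.
have := is_derive_ip_const oJ Jv l'e ddl (is_derive_cst (e4 R) v 1).
by rewrite -(scale0r (e4 R)) ipZr mul0r addr0.
Qed.

(** In the orthonormal frame [l, l', n, e4] of signs +, -, +, -, the products of [l''] with the
    frame vectors are 1, 0, [kappa], 0. *)
Lemma spherical_curvature_sqr v : J v ->
  ip (derive1 (derive1 l) v) (derive1 (derive1 l) v)
    = 1 + spherical_curvature l n v ^+ 2.
Proof.
move=> Jv; have [l'l l''l l''l'] := spherical_curve_products Jv.
have [le l'e l''e] := spherical_curve_e4 Jv.
have [[_ ll] l'l'] : in_S21 (l v) /\ ip (derive1 l v) (derive1 l v) = -1.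
  by case: hM => _ _ _ _; apply.
have [n3 nn nl nl'] := hn.2 v Jv.
have ne : ip (n v) (e4 R) = 0 by rewrite ip_e4 n3 oppr0.
rewrite /spherical_curvature.
move: (derive1 (derive1 l) v) (derive1 l v) (l v) (n v)
  l'l l''l l''l' le l'e l''e ll l'l' nn nl nl' ne => l2 l1 l0 nv *.
rewrite (@ip_orthonormal_expansion _ (fun i => nth 0 [:: l0; l1; nv; e4 R] i)
  (fun i => nth 0 [:: 1; -1; 1; -1] i)).
- rewrite !big_ord_recl big_ord0/= /bump/=.
  have -> : ip l2 l0 = 1 by [].
  have -> : ip l2 l1 = 0 by [].
  have -> : ip l2 (e4 R) = 0 by [].
  by ring.
- by case=> -[|[|[|[|//]]]] ?/=; ring.
- by case=> -[|[|[|[|//]]]] ?; case=> -[|[|[|[|//]]]] ?/=;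
    rewrite -?val_eqE/= ?mulr1n ?mulr0n ?ip_e4_e4//; rewrite ipC.
Qed.

Section Point.
Variables (u v : R).
Hypotheses (Iu : I u) (Jv : J v).
Let z := meridian_surface f g l.

Let fgE : [/\ f u != 0, derive1 f u ^+ 2 - derive1 g u ^+ 2 = 1 & 0 < derive1 g u].
Proof. by case: hM => _ _ _ + _; apply. Qed.

Lemma meridian_z_u s t : I s ->
  z_u z s t = derive1 f s *: l t + derive1 g s *: e4 R.
Proof.
case: hM => _ _ [sf sg _] _ _ Is; rewrite /z_u derive1E.
have df := is_derive_derive1 (@sf 0%N s Is).
have dg := is_derive_derive1 (@sg 0%N s Is).
have [_ ->] := is_deriveD (is_derive_scale df (is_derive_cst (l t) s 1))
  (is_derive_scale dg (is_derive_cst (e4 R) s 1)).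
by rewrite !scaler0 !addr0.
Qed.

Lemma meridian_z_v t : J t -> z_v z u t = f u *: derive1 l t.
Proof.
move=> Jt; rewrite /z_v derive1E; have [dl _] := is_derive_curve Jt.
have [_ ->] := is_deriveD (is_derive_scale (is_derive_cst (f u) t 1) dl)
  (is_derive_cst (g u *: e4 R) t 1).
by rewrite scale0r add0r addr0.
Qed.

Lemma meridian_z_uu : z_uu z u v =
  derive1 (derive1 f) u *: l v + derive1 (derive1 g) u *: e4 R.
Proof.
case: hM => -[_ oI _] _ [sf sg _] _ _; rewrite /z_uu derive1E.
have df := is_derive_derive1 (@sf 1%N u Iu).
have dg := is_derive_derive1 (@sg 1%N u Iu).
have := is_deriveD (is_derive_scale df (is_derive_cst (l v) u 1))
  (is_derive_scale dg (is_derive_cst (e4 R) u 1)).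
have /near_eq_is_derive/[apply] : \forall s \near u,
    (fun s => derive1 f s *: l v + derive1 g s *: e4 R) s = z_u z s v.
  have : nbhs u I by exact: open_nbhs_nbhs.
  by apply: filterS => s Is; rewrite meridian_z_u.
by move=> [_ ->]; rewrite !scaler0 !addr0.
Qed.

Lemma meridian_z_vv : z_vv z u v = f u *: derive1 (derive1 l) v.
Proof.
case: hM => _ [_ oJ _] _ _ _; rewrite /z_vv derive1E.
have [_ ddl] := is_derive_curve Jv.
have := is_derive_scale (is_derive_cst (f u) v 1) ddl.
have /near_eq_is_derive/[apply] : \forall t \near v,
    (fun t => f u *: derive1 l t) t = z_v z u t.
  have : nbhs v J by exact: open_nbhs_nbhs.
  by apply: filterS => t Jt; rewrite meridian_z_v.
by move=> [_ ->]; rewrite scale0r add0r.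
Qed.

(** Here [r = f u]. The vector [w = z_uu - f^-2 z_vv] is orthogonal to [z_v] and has product
    [- f' / f] with [z_u], so [H = (w + (f' / f) z_u) / 2]; its square is then computed from the
    products of [l], [l''] and [e4]. *)
Lemma meridian_mean_curvature c :
  (exists2 H, is_mean_curvature_vector z u v H & ip H H = c) <->
  spherical_curvature l n v ^+ 2 - meridian_q f g u ^+ 2 = 4 * c * f u ^+ 2.
Proof.
have [f0 fg1 g'0] := fgE; have g'n0 : derive1 g u != 0 by rewrite gt_eqF.
have [l'l l''l l''l'] := spherical_curve_products Jv.
have [le l'e l''e] := spherical_curve_e4 Jv.
have [[_ ll] l'l'] : in_S21 (l v) /\ ip (derive1 l v) (derive1 l v) = -1.
  by case: hM => _ _ _ _; apply.
have l''l'' := spherical_curvature_sqr Jv.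
have g''E : derive1 (derive1 g) u
    = (derive1 g u)^-1 * (derive1 f u * derive1 (derive1 f) u).
  case: hM => oI _ [sf sg _] hfg _.
  by rewrite (meridian_derive2 oI sf sg hfg)// mulKf.
have ee := ip_e4_e4 R.
have zuE := meridian_z_u v Iu; have zvE := meridian_z_v Jv.
have zu1 : ip (z_u z u v) (z_u z u v) = 1.
  rewrite zuE -fg1; move: (l v) (e4 R) ll le ee => l0 e ll le ee.
  by rewrite !(ipDl, ipDr, ipZl, ipZr) (ipC e) ll le ee; ring.
have zuzv : ip (z_u z u v) (z_v z u v) = 0.
  rewrite zuE zvE; move: (derive1 l v) (l v) (e4 R) l'l l'e => l1 l0 e l'l l'e.
  by rewrite !(ipDl, ipZl, ipZr) !(ipC _ l1) l'l l'e; ring.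
have zv1 : ip (z_v z u v) (z_v z u v) = - f u ^+ 2.
  rewrite zvE; move: (derive1 l v) l'l' => l1 l'l'.
  by rewrite ipZl ipZr l'l'; ring.
have HE := mean_curvature_vector_orthogonal f0 zu1 zuzv zv1.
set H0 := 2^-1 *: _ in HE.
have -> : (exists2 H, is_mean_curvature_vector z u v H & ip H H = c)
    <-> ip H0 H0 = c.
  by split=> [[H /HE ->]//|H0c]; exists H0 => //; apply/HE.
suff -> : ip H0 H0 = (spherical_curvature l n v ^+ 2 - meridian_q f g u ^+ 2)
    / (4 * f u ^+ 2).
  have f40 : 4 * f u ^+ 2 != 0 by rewrite mulf_neq0 ?expf_neq0.
  by split=> [<-|->]; field.
rewrite /H0 (normal_part_orthogonal f0 zu1 zuzv zv1).
rewrite zuE zvE meridian_z_uu meridian_z_vv /meridian_q g''E.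
move: (spherical_curvature l n v) l''l'' => k.
move: (derive1 (derive1 l) v) (derive1 l v) (l v) (e4 R)
  l'l l''l l''l' le l'e l''e ll l'l' ee
  => l2 l1 l0 e l1l0 l2l0 l2l1 l0e l1e l2e l0l0 l1l1 ee l2l2.
move: (derive1 (derive1 f) u) (derive1 f u) (derive1 g u) (f u) f0 g'n0 fg1
  => f2 f1 g1 F F0 g10 fg1.
have f12 : f1 ^+ 2 = 1 + g1 ^+ 2 by rewrite -fg1; ring.
set w := _ - _ *: (F *: l2).
have wu : ip w (f1 *: l0 + g1 *: e) = - (f1 / F).
  rewrite /w -scaleNr !(ipDl, ipDr, ipZl, ipZr) (ipC e) l0l0 l2l0 l2e l0e ee.
  by field; rewrite F0.
have wv : ip w (F *: l1) = 0.
  by rewrite /w -scaleNr !(ipDl, ipZl, ipZr) !(ipC _ l1) l1l0 l1e (ipC l1) l2l1; ring.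
rewrite wu wv mulr0 scale0r addr0 scaleNr opprK.
rewrite /w -scaleNr !(ipDl, ipDr, ipZl, ipZr) (ipC e) (ipC l0 l2) (ipC e).
rewrite l0l0 l2l0 l2e l0e ee l2l2.
(* The factor [f1 ^+ 2 - g1 ^+ 2], which is [<z_u, z_u>], is kept visible here so that the
   unit-speed relation, unknown to [field], can be rewritten. *)
transitivity ((k ^+ 2 + 1 - 2 * f1 ^+ 2 + f1 ^+ 2 * (f1 ^+ 2 - g1 ^+ 2)
   - 2 * F * f2 + F ^+ 2 * f2 ^+ 2
   - F ^+ 2 * f2 ^+ 2 * f1 ^+ 2 / g1 ^+ 2) / (4 * F ^+ 2)).
  by field; rewrite F0 g10.
by rewrite fg1 f12; field; rewrite F0 g10.
Qed.

End Point.

End MeridianSurfaceCurvature.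

Theorem theorem9 (R : realType) (I J : set R) (f g : R -> R)
    (l n : R -> 'rV[R]_4) (c : R)
    (hM : meridian_data_b I J f g l)
    (hn : spherical_normal J l n)
    (hc : c != 0)
    (hl : c < 0 -> exists2 v, J v & spherical_curvature l n v != 0) :
  constant_mean_curvature (meridian_surface f g l) I J c <->
  exists a : R,
    [/\ a != 0,
        (forall v, J v -> spherical_curvature l n v = a)
      & exists (b : R) (s e : bool), meridian_determined I f g a b c s e].
Proof.
have [oI oJ [sf sg sl] fg _] := hM.
have H u v (Iu : I u) (Jv : J v) := meridian_mean_curvature hM hn Iu Jv c.
split=> [cmc|[a [a0 ka [b [s [e det]]]]] u v Iu Jv].
- have [itvJ _ [v0 Jv0]] := oJ; have [_ _ [u0 Iu0]] := oI.
  have {}cmc u v : I u -> J v -> spherical_curvature l n v ^+ 2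
      = meridian_q f g u ^+ 2 + 4 * c * f u ^+ 2.
    by move=> Iu Jv; rewrite -((H u v Iu Jv).1 (cmc u v Iu Jv)) addrC subrK.
  pose a := spherical_curvature l n v0.
  (* Separation of variables: at the fixed parameter [u0] the right side of [cmc] does not involve
     [v]. *)
  have k2 v : J v -> spherical_curvature l n v ^+ 2 = a ^+ 2.
    by move=> Jv; rewrite (cmc u0)// (cmc u0).
  have a0 : a != 0.
    (* For [c > 0], [a^2 = q^2 + 4 c f^2] is positive. For [c < 0] that sum has no definite sign,
       and [hl] excludes [a = 0]. *)
    rewrite -sqrf_eq0; have [c0|c0] := ltP c 0.
      by have [v Jv] := hl c0; rewrite -sqrf_eq0 k2.
    have cpos : 0 < c by rewrite lt_neqAle eq_sym hc.
    have f2 : 0 < f u0 ^+ 2 by rewrite exprn_even_gt0//=; case: (fg u0 Iu0).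
    by rewrite /a (cmc u0)// gt_eqF// ltr_wpDl ?sqr_ge0// (mulr_gt0 _ f2)// mulr_gt0.
  have ck v : J v -> {for v, continuous (spherical_curvature l n)}.
    move=> Jv; apply: derivable_continuous.
    have dl := is_derive_derive1 (@sl 2%N v Jv).
    by have [] := is_derive_ip dl (is_derive_derive1 (@hn.1 0%N v Jv)).
  have [|d kd] := sqr_eq_sign (q := cst a) itvJ ck _ (fun _ _ => a0 : cst a _ != 0) k2.
    by move=> v _; exact: cst_continuous.
  (* At [v0] the curvature is [a] by definition, so [kd] there identifies [(-1) ^+ d * a] with
     [a]. *)
  exists a; split=> //; first by move=> v Jv; exact: etrans (kd v Jv) (esym (kd v0 Jv0)).
  apply: determined_of_meridian_q => // u Iu.
  by rewrite /radicand -(k2 v0 Jv0) (cmc u)// addrK.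
- apply/(H u v Iu Jv); rewrite ka//.
  rewrite (meridian_q_of_determined oI sf sg fg hc a0 det Iu) /radicand.
  by ring.
Qed.
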